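(* Let $m\ge 1$ and let $\sigma=\sigma_1\sigma_2\cdots\sigma_m\in\mathfrak{S}_m$ be a permutation, regarded as a consecutive pattern, with $\sigma_1=1$. Then, as formal power series in $z$ with coefficients in $\mathbb{Q}[u]$, $$C_\sigma(u,z)=1+\ln P_\sigma(u,z).$$
   Context: $\mathfrak{S}_n$ denotes the set of permutations $\pi=\pi_1\pi_2\cdots\pi_n$ of $\{1,\dots,n\}$ in one-line notation ($\mathfrak{S}_0$ consists of the empty permutation). Two words $a_1\cdots a_m$ and $b_1\cdots b_m$ of distinct integers are order-isomorphic if $a_i<a_j \iff b_i<b_j$ for all $i,j$. Linear occurrences: for a consecutive pattern $\sigma=\sigma_1\cdots\sigma_m\in\mathfrak{S}_m$ and $\pi\in\mathfrak{S}_n$, $o_\sigma(\pi)$ is the number of indices $i$ with $1\le i\le n-m+1$ such that $\pi_i\pi_{i+1}\cdots\pi_{i+m-1}$ is order-isomorphic to $\sigma_1\cdots\sigma_m$. Circular permutations: for $\pi\in\mathfrak{S}_n$, $[\pi]$ is the set of all rotations $\pi_i\pi_{i+1}\cdots\pi_n\pi_1\cdots\pi_{i-1}$ of $\pi$, called a circular permutation, and $[\mathfrak{S}_n]$ is the set of all circular permutations of length $n$, i.e. the set of equivalence classes of $\mathfrak{S}_n$ under rotation. ($[\mathfrak{S}_0]$ has exactly one element, the class of the empty permutation, with no occurrences of any pattern.) Circular occurrences: $c_\sigma[\pi]$ is the number of indices $i\in\{1,\dots,n\}$ such that the word $\pi_i\pi_{i+1}\cdots\pi_{i+m-1}$, with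 indices read cyclically modulo $n$ (so wrapping around from the end to the beginning is allowed), is order-isomorphic to $\sigma_1\cdots\sigma_m$; it is $0$ if $n<m$. It does not depend on the representative of $[\pi]$. Generating functions (formal power series in $z$ over $\mathbb{Q}[u]$): $$P_\sigma(u,z)=\sum_{n\ge0}\sum_{\pi\in\mathfrak{S}_n}u^{o_\sigma(\pi)}\frac{z^n}{n!},\qquad C_\sigma(u,z)=\sum_{n\ge0}\sum_{[\pi]\in[\mathfrak{S}_n]}u^{c_\sigma[\pi]}\frac{z^n}{n!}.$$ Both have constant term $1$ in $z$, and $\ln P_\sigma$ is the usual formal logarithm. *)

(* Defs.v *)
From mathcomp Require Import all_boot all_order all_fingroup all_algebra.

Set Implicit Arguments.
Unset Strict Implicit.
Unset Printing Implicit Defensive.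

Import GRing.Theory.

(* 'S_n permutes {0, ..., n-1}; one-line words are shifted to {1, ..., n}. *)
Definition one_line (n : nat) (p : 'S_n) : seq nat :=
  [seq (val (p i)).+1 | i <- enum 'I_n].

Definition order_iso (a b : seq nat) : bool :=
  (size a == size b) &&
  [forall i : 'I_(size a), forall j : 'I_(size a),
     (nth 0 a i < nth 0 a j) == (nth 0 b i < nth 0 b j)].

(* Positions are 0-based: i ranges over 0 <= i <= n - m. *)
Definition lin_occ (m n : nat) (sigma : 'S_m) (p : 'S_n) : nat :=
  #|[set i : 'I_n | (i + m <= n) &&
      order_iso (take m (drop i (one_line p))) (one_line sigma)]|.

(* For m <= n, the first m letters of the rotation starting at position i are
   the letters at positions i, ..., i + m - 1 read cyclically. *)
Definition cyc_occ (m n : nat) (sigma : 'S_m) (p : 'S_n) : nat :=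
  #|[set i : 'I_n | (m <= n) &&
      order_iso (take m (rot i (one_line p))) (one_line sigma)]|.

(* The index i = n repeats i = 0; it is included so that the class of the
   empty permutation is not empty. *)
Definition circ (n : nat) (p : 'S_n) : {set 'S_n} :=
  [set q : 'S_n | [exists i : 'I_n.+1, one_line q == rot i (one_line p)]].

Definition circ_perms (n : nat) : {set {set 'S_n}} :=
  [set circ p | p : 'S_n].

(* Evaluated on an arbitrary representative; see circ_occE. The default 0 is
   never used on circ_perms n. *)
Definition circ_occ (m n : nat) (sigma : 'S_m) (X : {set 'S_n}) : nat :=
  if [pick p in X] is Some p then cyc_occ sigma p else 0.

Lemma size_one_line (n : nat) (p : 'S_n) : size (one_line p) = n.
Proof. by rewrite size_map size_enum_ord. Qed.

Lemma cyc_occ_rot (m n : nat) (sigma : 'S_m) (p q : 'S_n) (k : nat) :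
  k <= n -> one_line q = rot k (one_line p) -> cyc_occ sigma q = cyc_occ sigma p.
Proof.
case: n p q => [|n] p q le_kn Eq.
  by apply: eq_card => -[].
rewrite /cyc_occ Eq.
pose f (i : 'I_n.+1) : 'I_n.+1 := (i + inZp k)%R.
have f_inj : injective f by apply: addIr.
rewrite -[RHS](card_preimset _ f_inj); apply: eq_card => i; rewrite !inE.
congr (_ && order_iso (take _ _) _).
rewrite rot_add_mod ?size_one_line //; last exact: ltnW.
rewrite /f /=; case: leqP => [le_ik|lt_ik].
  rewrite modnDmr addnC; move: le_ik; rewrite leq_eqVlt => /orP[/eqP e|lt].
    by rewrite addnC e modnn -{1}(size_one_line p) rot_size rot0.
  by rewrite addnC modn_small // addnC.
rewrite modnDmr; congr rot.
have le_ik : n.+1 <= i + k by apply: ltnW.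
rewrite -{2}(subnK le_ik) modnDr modn_small //.
by rewrite ltn_subLR // -addSn leq_add.
Qed.

Lemma circ_occE (m n : nat) (sigma : 'S_m) (p : 'S_n) :
  circ_occ sigma (circ p) = cyc_occ sigma p.
Proof.
rewrite /circ_occ; case: pickP => [q|/(_ p)].
  rewrite inE => /existsP[i /eqP Eq]; apply: (cyc_occ_rot _ _ Eq).
  by rewrite -ltnS.
by rewrite inE => /existsP[]; exists ord0; rewrite rot0.
Qed.

Local Open Scope ring_scope.

(* Formal power series in z over Q[u], given by their coefficient sequences;
   the indeterminate u is 'X. *)
Definition fps := nat -> {poly rat}.

Definition fps_one : fps := fun n => (n == 0)%N%:R.
Definition fps_add (F G : fps) : fps := fun n => F n + G n.
Definition fps_sub (F G : fps) : fps := fun n => F n - G n.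
Definition fps_mul (F G : fps) : fps := fun n => \sum_(i < n.+1) F i * G (n - i)%N.
Definition fps_exp (F : fps) (k : nat) : fps := iter k (fps_mul F) fps_one.

(* ln F = sum_(k >= 1) (-1)^(k+1) (F - 1)^k / k, for F with constant term 1.
   The terms with k > n do not contribute to the coefficient of z^n, by
   fps_exp_small. *)
Definition fps_ln (F : fps) : fps := fun n =>
  \sum_(1 <= k < n.+1) ((-1) ^+ k.+1 / k%:R : rat) *: fps_exp (fps_sub F fps_one) k n.

Lemma fps_exp_small (F : fps) (k n : nat) :
  F 0%N = 0 -> (n < k)%N -> fps_exp F k n = 0.
Proof.
move=> F0; elim: k n => // k IHk n lt_nk; rewrite /fps_exp iterS /fps_mul.
apply: big1 => -[[|i] lt_i] _ /=; first by rewrite F0 mul0r.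
rewrite [X in _ * X]IHk ?mulr0 //.
case: n lt_nk lt_i => // n lt_nk lt_i.
by rewrite subSS (leq_ltn_trans (leq_subr _ _)).
Qed.

Definition P_gf (m : nat) (sigma : 'S_m) : fps := fun n =>
  (n`!%:R^-1 : rat) *: \sum_(p : 'S_n) 'X^(lin_occ sigma p).

Definition C_gf (m : nat) (sigma : 'S_m) : fps := fun n =>
  (n`!%:R^-1 : rat) *: \sum_(X in circ_perms n) 'X^(circ_occ sigma X).

Lemma P_gf0 (m : nat) (sigma : 'S_m) : P_gf sigma 0%N = 1.
Proof.
rewrite /P_gf fact0 invr1 scale1r (bigD1 1%g) //= big1 ?addr0.
  by rewrite /lin_occ eq_card0 ?expr0 // => -[].
by move=> p /eqP[]; apply/permP => -[].
Qed.

Lemma C_gf0 (m : nat) (sigma : 'S_m) : C_gf sigma 0%N = 1.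
Proof.
have S0 (p : 'S_0) : p = 1%g by apply/permP => -[].
have -> : C_gf sigma 0%N = \sum_(X in [set circ (1%g : 'S_0)]) 'X^(circ_occ sigma X).
  rewrite /C_gf fact0 invr1 scale1r; apply: eq_bigl => X.
  rewrite inE; apply/imsetP/eqP => [[p _ ->]|->]; first by rewrite (S0 p).
  by exists 1%g.
by rewrite big_set1 circ_occE /cyc_occ eq_card0 ?expr0 // => -[].
Qed.

(* Main.v *)
Require Import Defs.
From mathcomp Require Import all_boot all_order all_fingroup all_algebra.

(** Call [t] the word of [sigma]; its first letter is its least one.

    On the circular side, every nonempty circular permutation has exactly one
    representative that starts with the least letter. A window that wraps
    around contains this letter after its first position, so it cannot match
    [t]: circular occurrences are linear occurrences of that representative
    ([cyc_occ_lin_occ]). Hence the coefficient of z^(n+1) in C is b_n / (n+1)!,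
    where b_n ([occ_gen_min]) sums u^occurrences over the words of length n+1
    that start with their least letter.

    On the linear side, let a_n ([occ_gen]) be n! times the coefficient of z^n
    in P. Cut a permutation of size n+1 before its least letter. By the same
    observation no occurrence of [t] straddles the cut ([occ_cat]), and the
    relative orders of the two parts vary independently ([sum_cut]), so
    a_(n+1) = sum_k binomial(n, k) a_k b_(n-k) ([occ_gen_rec]).

    In terms of power series this says P' = P C'. Since also P' = P (ln P)'
    ([fps_ln_deriv]) and P has constant term 1, C and 1 + ln P have the same
    derivative, and both have constant term 1. *)

Set Implicit Arguments.
Unset Strict Implicit.
Unset Printing Implicit Defensive.

Import GRing.Theory Num.Theory.

(** * Order-isomorphic words and occurrences *)

Lemma order_isoP (a b : seq nat) :
  reflect (size a = size b /\ forall i j, i < size a -> j < size a ->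
             (nth 0 a i < nth 0 a j) = (nth 0 b i < nth 0 b j))
          (order_iso a b).
Proof.
apply: (iffP andP) => [[/eqP sab /forallP iso]|[sab iso]]; split=> //.
- move=> i j lt_i lt_j.
  by have /forallP/(_ (Ordinal lt_j))/eqP := iso (Ordinal lt_i).
- exact/eqP.
by apply/forallP=> i; apply/forallP=> j; rewrite iso.
Qed.

Lemma order_iso_sym (a b : seq nat) : order_iso a b -> order_iso b a.
Proof.
by case/order_isoP=> sab iso; apply/order_isoP; split=> // i j; rewrite -sab => *;
  rewrite iso.
Qed.

Lemma order_iso_trans (a b c : seq nat) :
  order_iso a b -> order_iso b c -> order_iso a c.
Proof.
case/order_isoP=> sab iso /order_isoP[sbc iso']; apply/order_isoP.
by split=> [|i j lt_i lt_j]; rewrite ?sab // iso // iso' // -sab.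
Qed.

Lemma order_iso_map (f : nat -> nat) (w : seq nat) :
  {mono f : x y / x < y} -> order_iso (map f w) w.
Proof.
move=> f_mono; apply/order_isoP; rewrite size_map; split=> // i j lt_i lt_j.
by rewrite !(nth_map 0) // f_mono.
Qed.

Lemma order_iso_take (n : nat) (a b : seq nat) :
  order_iso a b -> order_iso (take n a) (take n b).
Proof.
case/order_isoP=> sab iso; apply/order_isoP.
rewrite !size_take_min sab; split=> // i j; rewrite !leq_min => /andP[lt_in lt_i].
by case/andP=> lt_jn lt_j; rewrite !nth_take // iso // sab.
Qed.

Lemma order_iso_drop (n : nat) (a b : seq nat) :
  order_iso a b -> order_iso (drop n a) (drop n b).
Proof.
case/order_isoP=> sab iso; apply/order_isoP.
rewrite !size_drop sab; split=> // i j; rewrite !ltn_subRL => lt_i lt_j.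
by rewrite !nth_drop iso // sab.
Qed.

Lemma order_iso_cons (x y : nat) (a b : seq nat) :
  all (ltn x) a -> all (ltn y) b -> order_iso a b -> order_iso (x :: a) (y :: b).
Proof.
move=> /(all_nthP 0) xa /(all_nthP 0) yb /order_isoP[sab iso]; apply/order_isoP.
have {}xa k : k < size b -> x < nth 0 a k by rewrite -sab; apply: xa.
have {}yb k : k < size b -> y < nth 0 b k by apply: yb.
rewrite /= sab; split=> // -[|i] [|j]; rewrite ?ltnn //= ?ltnS => lt_i lt_j.
- by rewrite xa ?yb.
- by rewrite ltnNge (ltnW (xa _ _)) // ltnNge (ltnW (yb _ _)).
by rewrite iso ?sab.
Qed.

(** A window that overflows the end of [w] is shorter than [t], hence never
    order-isomorphic to it: the windows counted are those that fit in [w]. *)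
Definition occ (t w : seq nat) : nat :=
  count (fun i => order_iso (take (size t) (drop i w)) t) (iota 0 (size w)).

Lemma occ_order_iso (t a b : seq nat) : order_iso a b -> occ t a = occ t b.
Proof.
move=> iso; rewrite /occ; case/order_isoP: (iso) => -> _.
apply: eq_count => i /=.
have iso_i := order_iso_take (size t) (order_iso_drop i iso).
apply/idP/idP; apply: order_iso_trans => //; exact: order_iso_sym.
Qed.

(** A window that starts in [a] and reaches [x] has a non-initial letter, [x],
    below its first letter, which the pattern [t] forbids. *)
Lemma occ_cat (t a b : seq nat) (x : nat) :
  (forall j, j < size t -> nth 0 t 0 <= nth 0 t j) -> all (ltn x) a ->
  occ t (a ++ x :: b) = occ t a + occ t (x :: b).
Proof.
move=> t_min /(all_nthP 0) a_gt.
have {}a_gt k : k < size a -> x < nth 0 a k by apply: a_gt.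
rewrite /occ size_cat iotaD count_cat add0n.
congr (_ + _).
  apply: eq_in_count => i; rewrite mem_iota /= add0n => lt_i.
  rewrite drop_cat lt_i take_cat size_drop; case: ltnP => // le_ia.
  have [fits|overflow] := leqP (size t) (size a - i).
    have -> : size t - (size a - i) = 0 by apply/eqP; rewrite subn_eq0.
    by rewrite take0 cats0 take_oversize // size_drop.
  apply/idP/idP.
    case/order_isoP=> st iso.
    have pos_ai : 0 < size a - i by rewrite subn_gt0.
    have := iso (size a - i) 0; rewrite st overflow (leq_ltn_trans _ overflow) //.
    rewrite !nth_cat !size_drop ltnn subnn pos_ai nth_drop addn0.
    have -> : nth 0 (take (size t - (size a - i)) (x :: b)) 0 = x.
      by move: (overflow); rewrite -subn_gt0; case: (size t - (size a - i)).
    rewrite a_gt // => /(_ isT isT)/esym.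
    by rewrite ltnNge t_min.
  case/order_isoP=> st _; move: overflow; rewrite -st size_take_min size_drop.
  by rewrite ltnNge geq_minr.
rewrite -[X in iota X](addn0 (size a)) iotaDl count_map.
by apply: eq_count => i /=; rewrite drop_cat ltnNge leq_addr addKn.
Qed.

(** * One-line words *)

Definition word (n : nat) (f : 'I_n -> nat) : seq nat := [seq f i | i <- enum 'I_n].

Lemma size_word n (f : 'I_n -> nat) : size (word f) = n.
Proof. by rewrite size_map size_enum_ord. Qed.

Lemma nth_word n (f : 'I_n -> nat) (i : 'I_n) : nth 0 (word f) i = f i.
Proof. by rewrite (nth_map i) ?size_enum_ord // nth_ord_enum. Qed.

Lemma eq_word n (f g : 'I_n -> nat) : f =1 g -> word f = word g.
Proof. by move=> fg; apply: eq_map. Qed.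

Lemma word_cat i j (f : 'I_(i + j) -> nat) :
  word f = word (fun x => f (lshift j x)) ++ word (fun y => f (rshift i y)).
Proof.
apply: (@eq_from_nth _ 0) => [|k]; rewrite ?size_cat !size_word // => lt_k.
rewrite -[k]/(val (Ordinal lt_k)); move: (Ordinal lt_k) => {lt_k}k.
rewrite nth_word nth_cat size_word; case: (split_ordP k) => x -> /=.
  by rewrite nth_word.
by rewrite addKn nth_word.
Qed.

Lemma order_iso_word n (f g : 'I_n -> nat) :
  (forall i j, (f i < f j) = (g i < g j)) -> order_iso (word f) (word g).
Proof.
move=> fg; apply/order_isoP; rewrite !size_word; split=> // i j lt_i lt_j.
by rewrite !(nth_word _ (Ordinal lt_i), nth_word _ (Ordinal lt_j)).
Qed.

(** The permutation sends [i] to the rank of [f i] among the values of [f]. *)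
Lemma exists_standardization n (f : 'I_n -> nat) :
  injective f -> exists p : 'S_n, forall i j, (f i < f j) = (p i < p j).
Proof.
move=> f_inj; pose rk i := #|[set j | f j < f i]|.
have rk_mono i j : (f i < f j) = (rk i < rk j).
  have rk_homo a b : f a < f b -> rk a < rk b.
    move=> lt_ab; apply: proper_card; apply/properP; split.
      by apply/subsetP=> k; rewrite !inE => /ltn_trans->.
    by exists a; rewrite !inE ?ltnn.
  case: (ltngtP (f i) (f j)) => [/rk_homo->|/rk_homo lt_ji|/f_inj->]; rewrite ?ltnn //.
  by rewrite ltnNge ltnW.
have rk_lt i : rk i < n.
  rewrite -[X in _ < X](card_ord n) -cardsT; apply: proper_card.
  by apply/properP; split; [apply: subsetT | exists i; rewrite !inE ?ltnn].
have rk_inj : injective (fun i => Ordinal (rk_lt i)).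
  move=> i j [e]; apply: f_inj.
  by case: (ltngtP (f i) (f j)) => //; rewrite rk_mono e ltnn.
by exists (perm rk_inj) => i j; rewrite !permE (rk_mono i j).
Qed.

Lemma one_line_lift_perm n (k : 'I_n.+1) (v : 'S_n) :
  one_line (lift_perm k ord0 v) =
  map S (take k (one_line v)) ++ 1 :: map S (drop k (one_line v)).
Proof.
have lt_k : k <= n by rewrite -ltnS.
apply: (@eq_from_nth _ 0) => [|i].
  rewrite size_one_line size_cat /= !size_map size_take_min size_drop !size_one_line.
  by rewrite (minn_idPl lt_k) addnS subnKC.
rewrite size_one_line => lt_i.
rewrite -[i]/(val (Ordinal lt_i)); move: (Ordinal lt_i) => {lt_i}i.
rewrite nth_word nth_cat size_map size_take_min size_one_line (minn_idPl lt_k).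
case: (unliftP k i) => [x|] ->; last by rewrite lift_perm_id ltnn subnn.
rewrite lift_perm_lift /= /bump; case: (leqP k x) => [le_kx|lt_xk].
  rewrite ltnNge leqW // subSn //= (nth_map 0) ?size_drop ?size_one_line.
    by rewrite nth_drop subnKC // nth_word.
  by rewrite ltn_sub2r // (leq_ltn_trans le_kx).
rewrite add0n lt_xk (nth_map 0) ?nth_take ?nth_word //.
by rewrite size_take_min size_one_line leq_min lt_xk /=.
Qed.

Lemma one_line_inj n : injective (@one_line n).
Proof.
move=> p q eq_pq; apply/permP=> i; apply: val_inj; apply: succn_inj.
by have := nth_word (fun i => (p i).+1) i; rewrite -[word _]/(one_line p) eq_pq nth_word.
Qed.

Lemma uniq_one_line n (p : 'S_n) : uniq (one_line p).
Proof.
by rewrite map_inj_uniq ?enum_uniq // => i j [/val_inj/perm_inj].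
Qed.

Lemma one_line_onto n (p : 'S_n) (w : seq nat) :
  perm_eq w (one_line p) -> exists q : 'S_n, one_line q = w.
Proof.
move=> w_p; have sp : size (one_line p) == n by rewrite size_one_line.
have /tuple_permP[s ->] : perm_eq w (Tuple sp) by [].
exists (s * p)%g; apply: eq_map => i.
by rewrite (tnth_nth 0) permM [RHS]nth_word.
Qed.

Lemma one_line_ord0 n (p : 'S_n.+1) : p ord0 = ord0 -> nth 0 (one_line p) 0 = 1.
Proof. by move=> p0; rewrite [LHS](nth_word _ ord0) p0. Qed.

(** * Circular permutations and their representatives starting with the minimum *)

Lemma circP n (p q : 'S_n) :
  reflect (exists k, one_line q = rot k (one_line p)) (q \in circ p).
Proof.
rewrite inE; apply: (iffP existsP) => [[i /eqP ->]|[k eq_q]]; first by exists i.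
have lt_k : minn k n < n.+1 by rewrite ltnS geq_minr.
by exists (Ordinal lt_k); rewrite eq_q [rot k _]rot_minn size_one_line.
Qed.

Lemma eq_circ n (p q : 'S_n) : q \in circ p -> circ q = circ p.
Proof.
case/circP=> k eq_q; apply/setP=> r.
apply/circP/circP=> -[i ->].
  by rewrite eq_q rot_rot_add; eexists.
by rewrite -[one_line p](rotK k) -eq_q /rotr rot_rot_add; eexists.
Qed.

Lemma circ_inj n : {in [pred p : 'S_n.+1 | p ord0 == ord0] &, injective (@circ n.+1)}.
Proof.
move=> p q; rewrite !inE => /eqP/one_line_ord0 p0 /eqP/one_line_ord0 q0 pq.
have : q \in circ p by rewrite pq; apply/circP; exists 0; rewrite rot0.
case/circP=> k eq_q; apply: one_line_inj; rewrite eq_q.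
case: (posnP k) => [->|k_gt0]; first by rewrite rot0.
case: (leqP (size (one_line p)) k) => [/rot_oversize->//|lt_k].
move: q0; rewrite eq_q /rot nth_cat size_drop subn_gt0 lt_k nth_drop addn0 -p0.
by move/eqP; rewrite nth_uniq ?uniq_one_line ?(leq_ltn_trans _ lt_k) // (gtn_eqF k_gt0).
Qed.

(** Rotating the least letter of a permutation to the front gives the
    representative. *)
Lemma circ_permsE n :
  circ_perms n.+1 = [set circ p | p in [pred p : 'S_n.+1 | p ord0 == ord0]].
Proof.
apply/setP=> X; apply/imsetP/imsetP=> -[p _ ->]; last by exists p.
have p1 : 1 \in one_line p.
  by apply/mapP; exists ((p^-1)%g ord0); rewrite ?mem_enum // permKV.
have /(@one_line_onto _ p)[q eq_q] :
  perm_eq (rot (index 1 (one_line p)) (one_line p)) (one_line p) by rewrite perm_rot.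
exists q; last by apply/esym/eq_circ/circP; eexists; apply: eq_q.
rewrite inE -val_eqE -eqSS -[(val (q _)).+1](nth_word (fun i => (q i).+1)).
by rewrite -[word _]/(one_line q) eq_q rot_index.
Qed.

(** * Occurrences of a pattern that starts with its minimum *)

Lemma lin_occE m (sigma : 'S_m) n (p : 'S_n) :
  lin_occ sigma p = occ (one_line sigma) (one_line p).
Proof.
rewrite /lin_occ /occ !size_one_line -val_enum_ord count_map cardsE cardE enumT.
rewrite size_filter -enumT; apply: eq_count => i; rewrite /= unfold_in /=.
case: (boolP (order_iso _ _)); rewrite ?andbF // => /order_isoP[+ _].
rewrite andbT size_take_min size_drop !size_one_line => /minn_idPl.
by rewrite leq_subRL // ltnW.
Qed.

Lemma one_line_min m (hm : 0 < m) (sigma : 'S_m) j :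
    sigma (Ordinal hm) = Ordinal hm ->
  j < size (one_line sigma) ->
  nth 0 (one_line sigma) 0 <= nth 0 (one_line sigma) j.
Proof.
rewrite size_one_line => sigma0 lt_j.
rewrite [X in X <= _](nth_word _ (Ordinal hm)).
by rewrite [X in _ <= X](nth_word _ (Ordinal lt_j)) sigma0.
Qed.

(** A window that wraps around contains the least letter of [p] after its first
    position, so it matches no pattern that starts with its minimum. *)
Lemma cyc_occ_lin_occ m (hm : 0 < m) (sigma : 'S_m) n (p : 'S_n.+1) :
    sigma (Ordinal hm) = Ordinal hm ->
  p ord0 = ord0 -> cyc_occ sigma p = lin_occ sigma p.
Proof.
move=> sigma0 p0; apply: eq_card => i; rewrite !inE.
have [fits|overflow] := leqP (i + m) n.+1.
  rewrite (leq_trans (leq_addl i m) fits) /rot takel_cat //.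
  by rewrite size_drop size_one_line leq_subRL // ltnW.
apply/negP=> /andP[le_mn /order_isoP[sz iso]].
have i_gt0 : 0 < i by move: overflow; case: (val i) => //; rewrite add0n ltnNge le_mn.
(* the position of the least letter of p in the window *)
pose j := n.+1 - i.
have lt_jm : j < m by rewrite ltn_subLR // ltnW.
have j_gt0 : 0 < j by rewrite subn_gt0.
have := iso j 0; rewrite sz size_one_line => /(_ lt_jm hm).
rewrite !nth_take // /rot !nth_cat size_drop size_one_line -/j ltnn subnn j_gt0.
rewrite nth_take // one_line_ord0 // nth_drop addn0 nth_word.
rewrite [X in _ = X]ltnNge (one_line_min sigma0) ?size_one_line // ltnS lt0n.
rewrite -[0]/(val (@ord0 n)) val_eqE -p0 (inj_eq perm_inj) -val_eqE /=.
by rewrite -lt0n i_gt0.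
Qed.

(** * Independence of the relative orders of the two parts of a word *)

Local Open Scope ring_scope.

(** Up to order isomorphism, permuting the positions of an injective word gives
    all permutations, each once. *)
Lemma sum_relabel (R : nmodType) (F : seq nat -> R) n (f : 'I_n -> nat) :
    (forall a b, order_iso a b -> F a = F b) -> injective f ->
  \sum_(s : 'S_n) F (word (f \o s)) = \sum_(p : 'S_n) F (one_line p).
Proof.
move=> F_iso /exists_standardization[p fp].
rewrite [RHS](reindex_inj (mulIg p)) /=; apply: eq_bigr => s _.
by apply/F_iso/order_iso_word => i j; rewrite /= !permM ltnS fp.
Qed.

Definition block_fun i j (s : 'S_i) (t : 'S_j) (k : 'I_(i + j)) : 'I_(i + j) :=
  match split k with inl x => lshift j (s x) | inr y => rshift i (t y) end.

Lemma block_fun_inj i j (s : 'S_i) (t : 'S_j) : injective (block_fun s t).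
Proof.
apply: (can_inj (g := block_fun s^-1 t^-1)) => k; rewrite /block_fun.
by case: (split_ordP k) => x ->; rewrite (unsplitK (inl _), unsplitK (inr _)) permK.
Qed.

Definition block_perm i j (s : 'S_i) (t : 'S_j) : 'S_(i + j) :=
  perm (@block_fun_inj i j s t).

(** The relative orders of the first [k] and of the last [n - k] letters of a
    permutation are independent. The group S_k x S_(n-k) acts on positions;
    averaging over this action replaces the two parts of each fixed
    permutation by all their rearrangements, whose sums do not depend on that
    permutation by [sum_relabel]. *)
Lemma sum_cut (R : comPzRingType) (F G : seq nat -> R) n k : (k <= n)%N ->
    (forall a b, order_iso a b -> F a = F b) ->
    (forall a b, order_iso a b -> G a = G b) ->
  (\sum_(v : 'S_n) F (take k (one_line v)) * G (drop k (one_line v)))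
     *+ (k`! * (n - k)`!) =
  ((\sum_(s : 'S_k) F (one_line s)) * (\sum_(t : 'S_(n - k)) G (one_line t))) *+ n`!.
Proof.
move=> le_kn; move: (n - k)%N (subnKC le_kn) => j <- {le_kn} F_iso G_iso.
transitivity (\sum_(v : 'S_(k + j)) \sum_(s : 'S_k) \sum_(t : 'S_j)
    F (take k (one_line (block_perm s t * v)%g)) *
    G (drop k (one_line (block_perm s t * v)%g))).
  rewrite [RHS]exchange_big mulnC mulrnA -!card_Sn -!sumr_const.
  apply: eq_bigr => s _; rewrite [RHS]exchange_big /=; apply: eq_bigr => t _.
  by rewrite [LHS](reindex_inj (mulgI (block_perm s t))).
rewrite -[in RHS]card_Sn -sumr_const; apply: eq_bigr => v _.
pose f x := (v (lshift j x)).+1; pose g y := (v (rshift k y)).+1.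
have f_inj : injective f by move=> x y [/val_inj/perm_inj/lshift_inj].
have g_inj : injective g by move=> x y [/val_inj/perm_inj/rshift_inj].
rewrite -(sum_relabel F_iso f_inj) -(sum_relabel G_iso g_inj) mulr_suml.
apply: eq_bigr => s _; rewrite mulr_sumr; apply: eq_bigr => t _.
have -> : one_line (block_perm s t * v)%g = word (f \o s) ++ word (g \o t).
  rewrite /one_line -/(word _) word_cat; congr (_ ++ _); apply: eq_word => x /=.
    by rewrite permM permE /block_fun (unsplitK (inl _)).
  by rewrite permM permE /block_fun (unsplitK (inr _)).
by rewrite take_size_cat ?drop_size_cat ?size_word.
Qed.

(** * Recurrence for the linear occurrences *)

Lemma sum_lift_perm (R : nmodType) n (k l : 'I_n.+1) (F : 'S_n.+1 -> R) :
  \sum_(p : 'S_n.+1 | p k == l) F p = \sum_(v : 'S_n) F (lift_perm k l v).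
Proof.
rewrite (reindex (lift_perm k l)) /=.
  by apply: eq_bigl => v; rewrite lift_perm_id eqxx.
pose del a (p : 'S_n.+1) i := odflt i (unlift (p a) (p (lift a i))).
have delK a (p : 'S_n.+1) i : lift (p a) (del a p i) = p (lift a i).
  have : p a != p (lift a i) by rewrite (inj_eq perm_inj) neq_lift.
  by rewrite /del => /unlift_some[j -> ->].
have del_inj (p : 'S_n.+1) : injective (del k p).
  move=> i j eq_ij; apply: (@lift_inj _ k); apply: (@perm_inj _ p).
  by rewrite -!delK eq_ij.
exists (fun p => perm (@del_inj p)) => [v _ | p].
  by apply/permP=> i; rewrite permE; apply: (@lift_inj _ l);
     rewrite -{1}(lift_perm_id k l v) delK lift_perm_lift.
rewrite inE => /eqP pk; apply/permP=> i.
case: (unliftP k i) => [j|] ->; last by rewrite lift_perm_id.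
by rewrite lift_perm_lift permE -pk delK.
Qed.

Definition occ_gen (t : seq nat) (n : nat) : {poly rat} :=
  \sum_(p : 'S_n) 'X^(occ t (one_line p)).

(** The words of length [n + 1] that start with their least letter, written
    with the letter 0 in front so that it is below every letter of [map S w]
    for any word [w]. *)
Definition occ_gen_min (t : seq nat) (n : nat) : {poly rat} :=
  \sum_(p : 'S_n) 'X^(occ t (0%N :: map S (one_line p))).

(** Cut each permutation before its least letter, which no occurrence straddles,
    and sum over the position of that letter; the two parts are independent. *)
Lemma occ_gen_rec (t : seq nat) n :
    (forall j, (j < size t)%N -> (nth 0%N t 0 <= nth 0%N t j)%N) ->
  occ_gen t n.+1 =
  \sum_(k < n.+1) (occ_gen t k * occ_gen_min t (n - k)) *+ 'C(n, k).
Proof.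
move=> t_min; pose F w : {poly rat} := 'X^(occ t w).
pose G w : {poly rat} := 'X^(occ t (0%N :: map S w)).
have F_iso a b : order_iso a b -> F a = F b by rewrite /F => /occ_order_iso->.
have mapS_iso w : order_iso (map S w) w by apply: order_iso_map.
have mapS_gt0 w : all (ltn 0) (map S w) by rewrite all_map; apply/allP.
have G_iso a b : order_iso a b -> G a = G b.
  move=> ab; congr 'X^_; apply/occ_order_iso/order_iso_cons => //.
  apply: order_iso_trans (mapS_iso a) (order_iso_trans ab _).
  exact: order_iso_sym.
(* k is the position of the least letter of p *)
rewrite /occ_gen (partition_big (fun p : 'S_n.+1 => (p^-1)%g ord0) predT) //=.
apply: eq_bigr => k _.
have le_kn : (k <= n)%N by rewrite -ltnS.
transitivity (\sum_(v : 'S_n) F (take k (one_line v)) * G (drop k (one_line v))).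
  rewrite -(eq_bigl _ _ (P1 := fun p : 'S_n.+1 => p k == ord0)); last first.
    by move=> p; rewrite (can2_eq (permK p) (permKV p)) eq_sym.
  rewrite sum_lift_perm; apply: eq_bigr => v _.
  rewrite one_line_lift_perm occ_cat //; last first.
    apply/allP=> x /mapP[y y_v ->]; rewrite /= ltnS.
    by have /mapP[i _ ->] := mem_take y_v.
  rewrite exprD; congr ('X^_ * 'X^_); apply: occ_order_iso => //.
  apply: order_iso_cons => //.
    apply/allP=> x /mapP[y y_v ->]; rewrite /= ltnS.
    by have /mapP[i _ ->] := mem_drop y_v.
  by apply/order_isoP.
apply: (@mulIf _ (k`! * (n - k)`!)%:R).
  by rewrite -polyC_natr polyC_eq0 pnatr_eq0 -lt0n muln_gt0 !fact_gt0.
by rewrite !mulr_natr (sum_cut le_kn F_iso G_iso) -mulrnA bin_fact.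
Qed.

(** * Logarithmic derivative of a power series *)

(** This is F' = F (ln F)', at the coefficient of z^n. With F = 1 + g, the
    derivative of the logarithm series is g' times the geometric series of
    -g. Truncating F to a polynomial only changes higher coefficients, and
    truncating the logarithm series after the power [n + 1] leaves an error
    g' (-g)^(n+1), which is divisible by z^(n+1). *)
Lemma fps_ln_deriv (F : fps) n : F 0%N = 1 ->
  F n.+1 *+ n.+1 = \sum_(k < n.+1) F k * (fps_ln F (n - k).+1 *+ (n - k).+1).
Proof.
move=> F0; pose N := n.+2.
pose g : {poly {poly rat}} := \poly_(i < N) fps_sub F fps_one i.
have coef_g i : (i < N)%N -> g`_i = fps_sub F fps_one i by rewrite coef_poly => ->.
have g0 : g`_0 = 0 by rewrite coef_g // /fps_sub F0 subrr.
have coef_exp k i : (i < N)%N -> (g ^+ k)`_i = fps_exp (fps_sub F fps_one) k i.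
  elim: k i => [|k IHk] i lt_i; first by rewrite coef1.
  rewrite exprS coefM; apply: eq_bigr => j _.
  have lt_j : (j < N)%N by apply: leq_trans (ltn_ord j) lt_i.
  by rewrite coef_g // -/(fps_exp _ _) IHk // (leq_ltn_trans (leq_subr _ _)).
pose c k : rat := (-1) ^+ k.+1 / k%:R.
pose L : {poly {poly rat}} := \sum_(1 <= k < N) (c k)%:P *: g ^+ k.
have coef_L i : (i < N)%N -> L`_i = fps_ln F i.
  move=> lt_i; rewrite coef_sum (big_cat_nat (n := i.+1)) //=.
  rewrite [X in _ + X]big_nat_cond [X in _ + X]big1 ?addr0 => [|k]; last first.
    rewrite andbT => /andP[lt_ik _]; rewrite coefZ coef_exp // fps_exp_small ?mulr0 //.
    by rewrite /fps_sub F0 subrr.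
  by apply: eq_bigr => k _; rewrite coefZ coef_exp // mul_polyC.
have deriv_L : (1 + g) * L^`() = g^`() * (1 - (- g) ^+ n.+1).
  have -> : L^`() = g^`() * \sum_(i < n.+1) (- g) ^+ i.
    rewrite raddf_sum big_add1 big_mkord mulr_sumr; apply: eq_bigr => i _.
    rewrite /= derivZ deriv_exp /= -scaler_nat scalerA.
    have -> : (c i.+1)%:P * i.+1%:R = (-1) ^+ i :> {poly rat}.
      rewrite -(rmorph_nat (@polyC rat)) -polyCM /c divfK ?pnatr_eq0 //.
      by rewrite !exprS !mulN1r opprK rmorphXn rmorphN1.
    by rewrite (exprNn g) mulrCA -mul_polyC rmorphXn rmorphN1.
  rewrite mulrCA; congr (_ * _); have := subrX1 (- g) n.+1.
  by move/(congr1 -%R); rewrite opprB => ->; rewrite -mulNr opprB opprK.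
have g_dvd k : exists q, g ^+ k = 'X^k * q.
  have /factor_theorem[q ->] : root g 0 by rewrite /root horner_coef0 g0.
  by exists (q ^+ k); rewrite subr0 exprMn mulrC.
have -> : F n.+1 *+ n.+1 = (g^`() * (1 - (- g) ^+ n.+1))`_n.
  rewrite mulrBr mulr1 coefB coef_deriv coef_g // /fps_sub /fps_one /= subr0.
  rewrite exprNn; have [q ->] := g_dvd n.+1.
  by rewrite !(mulrCA _ 'X^_) coefXnM ltnSn subr0.
rewrite -deriv_L coefM; apply: eq_bigr => k _.
have lt_k : (k < N)%N by apply: ltnW (ltn_ord k).
rewrite coefD coef1 coef_g // /fps_sub addrC subrK coef_deriv coef_L //.
by rewrite !ltnS leq_subr.
Qed.

(** As F 0 = 1, the equation at [n] determines the coefficient [n + 1] of G from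
    the lower ones: it occurs in the term [k = 0] only, times [n + 1]. *)
Lemma fps_log_deriv_inj (F G H : fps) : F 0%N = 1 -> G 0%N = H 0%N ->
    (forall n, \sum_(k < n.+1) F k * (G (n - k).+1 *+ (n - k).+1) =
               \sum_(k < n.+1) F k * (H (n - k).+1 *+ (n - k).+1)) ->
  G =1 H.
Proof.
move=> F0 GH0 GH n; elim/ltn_ind: n => -[|n] IHn //.
have := GH n; rewrite !big_ord_recl subn0 F0 !mul1r.
have -> : \sum_(i < n) F (lift ord0 i) * (G (n - lift ord0 i).+1 *+ (n - lift ord0 i).+1) =
   \sum_(i < n) F (lift ord0 i) * (H (n - lift ord0 i).+1 *+ (n - lift ord0 i).+1).
  apply: eq_bigr => i _; rewrite IHn // ltnS ltn_subrL /=.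
  exact: leq_ltn_trans (ltn_ord i).
move/addIr; rewrite -(mulr_natr (G _)) -(mulr_natr (H _)); apply: mulIf.
by rewrite -polyC_natr polyC_eq0 pnatr_eq0.
Qed.

(** * Coefficients of the two generating functions *)

Lemma invfactS_mulrn (V : lmodType rat) n (x : V) :
  ((n.+1`!%:R^-1 : rat) *: x) *+ n.+1 = (n`!%:R^-1 : rat) *: x.
Proof.
rewrite -scaler_nat scalerA factS natrM invfM mulVKf //.
by rewrite pnatr_eq0.
Qed.

Lemma P_gfE m (sigma : 'S_m) n :
  P_gf sigma n = (n`!%:R^-1 : rat) *: occ_gen (one_line sigma) n.
Proof. by congr (_ *: _); apply: eq_bigr => p _; rewrite lin_occE. Qed.

Lemma C_gfS m (hm : (0 < m)%N) (sigma : 'S_m) n :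
    sigma (Ordinal hm) = Ordinal hm ->
  C_gf sigma n.+1 = (n.+1`!%:R^-1 : rat) *: occ_gen_min (one_line sigma) n.
Proof.
move=> sigma0; congr (_ *: _); rewrite circ_permsE (big_imset _ (@circ_inj n)) /=.
rewrite sum_lift_perm; apply: eq_bigr => v _.
rewrite circ_occE (cyc_occ_lin_occ sigma0) ?lift_perm_id // lin_occE.
rewrite one_line_lift_perm take0 drop0 /=; congr 'X^_; apply: occ_order_iso.
apply: order_iso_cons; last exact/order_isoP.
  by apply/allP=> x /mapP[y /mapP[i _ ->] ->].
by rewrite all_map; apply/allP.
Qed.

Lemma P_gf_deriv m (hm : (0 < m)%N) (sigma : 'S_m) n :
    sigma (Ordinal hm) = Ordinal hm ->
  P_gf sigma n.+1 *+ n.+1 =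
  \sum_(k < n.+1) P_gf sigma k * (C_gf sigma (n - k).+1 *+ (n - k).+1).
Proof.
move=> sigma0; rewrite P_gfE invfactS_mulrn occ_gen_rec; last first.
  by move=> j; apply: one_line_min sigma0.
rewrite scaler_sumr; apply: eq_bigr => k _; have le_kn : (k <= n)%N by rewrite -ltnS.
rewrite (C_gfS _ sigma0) invfactS_mulrn P_gfE -scalerAl -scalerAr scalerA.
rewrite -scaler_nat scalerA; congr (_ *: _).
rewrite -invfM -natrM -(bin_fact le_kn) natrM invfM mulrAC mulVf ?mul1r //.
by rewrite pnatr_eq0 -lt0n bin_gt0.
Qed.

Theorem theorem1 (m : nat) (hm : (0 < m)%N) (sigma : 'S_m)
    (hsigma : sigma (Ordinal hm) = Ordinal hm) :
  C_gf sigma =1 fps_add fps_one (fps_ln (P_gf sigma)).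
Proof.
apply: (fps_log_deriv_inj (P_gf0 sigma)) => [|n].
  by rewrite C_gf0 /fps_add /fps_ln big_geq // addr0.
rewrite -(P_gf_deriv n hsigma) fps_ln_deriv ?P_gf0 //.
by apply: eq_bigr => k _; rewrite /fps_add /fps_one add0r.
Qed.
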